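(* Let $E=(\mathbb{Z}\oplus\mathbb{Z})\rtimes_\theta\mathbb{Z}$ where $\theta(1)\in GL_2(\mathbb{Z})$ is an Anosov matrix, and let $\psi:\mathrm{Aut}(E)\to \mathrm{Aut}(\mathbb{Z})\times \mathrm{Aut}(\mathbb{Z}\oplus\mathbb{Z})$ be the natural homomorphism. The intersection of the image of $\psi$ with the subgroup $\{\mathrm{id}_{\mathbb{Z}}\}\times \mathrm{Aut}(\mathbb{Z}\oplus\mathbb{Z})$ is the subgroup generated by $(\mathrm{id}_{\mathbb{Z}},M_0)$ and $(\mathrm{id}_{\mathbb{Z}},-\mathrm{id}_{\mathbb{Z}\oplus\mathbb{Z}})$. If $\mathrm{Aut}_0(E)$ denotes the set of elements of $\mathrm{Aut}(E)$ which project under $\psi$ to elements of the form $(\mathrm{id}_{\mathbb{Z}},\tau)$, then there is a short exact sequence $$1\to(\mathbb{Z}\oplus\mathbb{Z})\rtimes_{M_0}\mathbb{Z}\to \mathrm{Aut}_0(E)\to\mathbb{Z}_2\to1,$$ where the map $\mathrm{Aut}_0(E)\to\mathbb{Z}_2$ is $\psi$ followed by the map sending $(\mathrm{id}_{\mathbb{Z}},M_0)$ to $0$ and $(\mathrm{id}_{\mathbb{Z}},-\mathrm{id}_{\mathbb{Z}\oplus\mathbb{Z}})$ to $1$. Further, the sequence splits, so $\mathrm{Aut}_0(E)\cong((\mathbb{Z}\oplus\mathbb{Z})\rtimes_{M_0}\mathbb{Z})\rtimes_\phi\mathbb{Z}_2$, and with respect to the splitting that sends the generator of $\mathbb{Z}_2$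 to the automorphism $\gamma_-$ lying over $(\mathrm{id}_{\mathbb{Z}},-\mathrm{id}_{\mathbb{Z}\oplus\mathbb{Z}})$, the action is given by $\phi(m,n,t)=(-m,-n,t)$.
   Context: A matrix $A\in GL_2(\mathbb{Z})$ is Anosov if it is not exceptional, where exceptional means: ($\det A=1$ and $|\mathrm{tr}A|\le2$) or ($\det A=-1$ and $\mathrm{tr}A=0$). $E$ is presented as $\langle d,b,v\mid db=bd,\ vdv^{-1}=\theta(1)\begin{pmatrix} 1 \\ 0 \end{pmatrix},\ vbv^{-1}=\theta(1)\begin{pmatrix} 0 \\ 1 \end{pmatrix}\rangle$, where $d^mb^n$ is identified with $\begin{pmatrix} m \\ n \end{pmatrix}\in\mathbb{Z}\oplus\mathbb{Z}$. The subgroup $\mathbb{Z}\oplus\mathbb{Z}=\langle d,b\rangle$ is characteristic in $E$, and $\psi$ sends an automorphism to the pair (induced automorphism of the quotient $\mathbb{Z}$, restriction to $\mathbb{Z}\oplus\mathbb{Z}$). $M_0\in GL_2(\mathbb{Z})$ is a matrix such that the centralizer of $\theta(1)$ in $GL_2(\mathbb{Z})$ equals $\{\pm M_0^\ell:\ell\in\mathbb{Z}\}\cong\mathbb{Z}_2\oplus\mathbb{Z}$ (such a matrix exists). $(\mathbb{Z}\oplus\mathbb{Z})\rtimes_{M_0}\mathbb{Z}$ is the semidirect product in which $1\in\mathbb{Z}$ acts by $M_0$. $\gamma_-\in \mathrm{Aut}(E)$ is given by $\gamma_-(d^mb^n)=d^{-m}b^{-n}$, $\gamma_-(v)=v$.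 $\mathbb{Z}_2=\mathbb{Z}/2\mathbb{Z}$. *)

(* Defs.v *)
From HB Require Import structures.
From mathcomp Require Import all_boot all_order all_algebra.
From mathcomp Require Import boolp classical_sets.
From mathcomp Require Import zify ring.

Set Implicit Arguments.
Unset Strict Implicit.
Unset Printing Implicit Defensive.

Import GRing.Theory Num.Theory Order.TTheory.

Local Open Scope group_scope.
Local Open Scope classical_set_scope.

Section GeneralGroups.

Definition generated (G : groupType) (S : set G) : set G :=
  smallest (fun H : set G => group_closed (mem H)) S.

Definition centralizer (G : groupType) (x : G) : set G :=
  [set y | commute x y].

Definition short_exact (G H K : groupType) (i : G -> H) (p : H -> K) : Prop :=
  [/\ injective i, range i = [set h | p h = 1] & range p = setT].

End GeneralGroups.

Section Aut.
Variable G : groupType.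

Definition is_aut (f : G -> G) : Prop :=
  {morph f : x y / x * y} /\ bijective f.

Record aut := Aut { aut_fun :> G -> G; _ : `[< is_aut aut_fun >] }.

HB.instance Definition _ := [isSub for aut_fun].
HB.instance Definition _ := [Choice of aut by <:].

Lemma autM (f : aut) : {morph f : x y / x * y}.
Proof. by case: f => f /= /asboolP[]. Qed.

Lemma aut_bij (f : aut) : bijective f.
Proof. by case: f => f /= /asboolP[]. Qed.

HB.instance Definition _ (f : aut) := isMultiplicative.Build G G f (autM f).

Lemma autP (f g : aut) : f =1 g -> f = g.
Proof. by move=> fg; apply/val_inj/funext. Qed.

Definition mk_aut (f : G -> G) (H : is_aut f) : aut := Aut (asboolT H).

Lemma aut_inv_ex (f : aut) : exists g : G -> G, cancel f g /\ cancel g f.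
Proof. by case: (aut_bij f) => g; exists g. Qed.

Lemma aut_one_subproof : is_aut idfun.
Proof. by split=> //; exists idfun. Qed.

Lemma aut_mul_subproof (f g : aut) : is_aut (f \o g).
Proof.
split; first by move=> x y /=; rewrite !autM.
by apply: bij_comp; apply: aut_bij.
Qed.

Lemma aut_inv_subproof (f : aut) : is_aut (sval (cid (aut_inv_ex f))).
Proof.
case: cid => g [fK gK] /=; split; last by exists f.
by apply: can2_gmulfM.
Qed.

Definition aut_one : aut := mk_aut aut_one_subproof.
Definition aut_mul (f g : aut) : aut := mk_aut (aut_mul_subproof f g).
Definition aut_inv (f : aut) : aut := mk_aut (aut_inv_subproof f).

Lemma aut_mulA : associative aut_mul.
Proof. by move=> f g h; apply: autP. Qed.
Lemma aut_mul1 : left_id aut_one aut_mul.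
Proof. by move=> f; apply: autP. Qed.
Lemma aut_mulr1 : right_id aut_one aut_mul.
Proof. by move=> f; apply: autP. Qed.
Lemma aut_mulV : left_inverse aut_one aut_inv aut_mul.
Proof. by move=> f; apply: autP => x /=; case: cid => g [fK gK] /=. Qed.
Lemma aut_mulrV : right_inverse aut_one aut_inv aut_mul.
Proof. by move=> f; apply: autP => x /=; case: cid => g [fK gK] /=. Qed.

HB.instance Definition _ :=
  isGroup.Build aut aut_mulA aut_mul1 aut_mulr1 aut_mulV aut_mulrV.

Lemma mulautE (f g : aut) x : (f * g) x = f (g x). Proof. by []. Qed.
Lemma oneautE x : (1 : aut) x = x. Proof. by []. Qed.
Lemma autK (f : aut) : cancel f (f^-1 : aut).
Proof. by move=> x; rewrite -mulautE mulVg. Qed.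
Lemma autVK (f : aut) : cancel (f^-1 : aut) f.
Proof. by move=> x; rewrite -mulautE mulgV. Qed.

Lemma aut1 (f : aut) : f 1 = 1.
Proof. by apply: (@mulgI _ (f 1)); rewrite -autM !mulg1. Qed.

End Aut.

(* sdprod theta is the semidirect product of G by H in which
   h x h^-1 = theta h x for x in G and h in H. *)
Section Sdprod.
Variables G H : groupType.

Record sdprod (theta : {multiplicative H -> aut G}) :=
  SDPair { sdl : G; sdr : H }.
Arguments SDPair {theta}.
Arguments sdl {theta}.
Arguments sdr {theta}.

Variable theta : {multiplicative H -> aut G}.
Local Notation GH := (sdprod theta).

Definition sdprod_pair (u : GH) : G * H := (sdl u, sdr u).
Definition pair_sdprod (u : G * H) : GH := SDPair u.1 u.2.
Lemma sdprod_pairK : cancel sdprod_pair pair_sdprod.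
Proof. by case. Qed.

HB.instance Definition _ := Choice.copy GH (can_type sdprod_pairK).

Definition sd_one : GH := SDPair 1 1.
Definition sd_mul (u v : GH) : GH :=
  SDPair (sdl u * theta (sdr u) (sdl v)) (sdr u * sdr v).
Definition sd_inv (u : GH) : GH :=
  SDPair (theta (sdr u)^-1 (sdl u)^-1) (sdr u)^-1.

Let theta1 : theta 1 = 1.
Proof. by apply: (@mulgI _ (theta 1)); rewrite -gmulfM !mulg1. Qed.

Lemma sd_mulA : associative sd_mul.
Proof.
by move=> u v w; rewrite /sd_mul /= gmulfM autM mulautE !mulgA.
Qed.
Lemma sd_mul1 : left_id sd_one sd_mul.
Proof. by case=> x h; rewrite /sd_mul /= theta1 !mul1g. Qed.
Lemma sd_mulr1 : right_id sd_one sd_mul.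
Proof. by case=> x h; rewrite /sd_mul /= aut1 !mulg1. Qed.
Lemma sd_mulV : left_inverse sd_one sd_inv sd_mul.
Proof. by case=> x h; rewrite /sd_mul /sd_inv /= -autM !mulVg aut1. Qed.
Lemma sd_mulrV : right_inverse sd_one sd_inv sd_mul.
Proof.
case=> x h; rewrite /sd_mul /sd_inv /= -mulautE -gmulfM mulgV theta1.
by rewrite oneautE mulgV.
Qed.

HB.instance Definition _ :=
  isGroup.Build GH sd_mulA sd_mul1 sd_mulr1 sd_mulV sd_mulrV.

Lemma sdlM (u v : GH) : sdl (u * v) = sdl u * theta (sdr u) (sdl v).
Proof. by []. Qed.
Lemma sdrM : {morph sdr : u v / u * v}. Proof. by []. Qed.

Definition sdinl (x : G) : GH := SDPair x 1.
Definition sdinr (h : H) : GH := SDPair 1 h.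

Lemma sdinlM : {morph sdinl : x y / x * y}.
Proof. by move=> x y; congr SDPair; rewrite ?mulg1 //= theta1. Qed.

Lemma sdprodE (u : GH) : u = sdinl (sdl u) * sdinr (sdr u).
Proof. by case: u => x h; congr SDPair; rewrite /= ?aut1 ?mulg1 ?mul1g. Qed.

Lemma sdinlJ h x : sdinr h * sdinl x = sdinl (theta h x) * sdinr h.
Proof.
by congr SDPair; rewrite /= ?theta1 ?mul1g ?mulg1 //= ?aut1 ?mulg1.
Qed.

End Sdprod.

Arguments sdprod {G H} theta.
Arguments SDPair {G H theta}.
Arguments sdl {G H theta}.
Arguments sdr {G H theta}.

Arguments sdinl {G H} theta.
Arguments sdinr {G H} theta.

Definition Z : groupType := GRing.to_multiplicative int.
Definition Zmod2 : groupType := GRing.to_multiplicative 'Z_2.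
(* These groups are additive: their unit 1%g is the number 0, and the
   generators below are the number 1. *)
Definition Zgen : Z := (1 : int)%R.
Definition Zmod2gen : Zmod2 := (1 : 'Z_2)%R.
(* The free abelian group of rank 2; d^m b^n is the column (m, n)^T. *)
Definition ZZ : groupType := GRing.to_multiplicative 'cV[int]_2.

Definition ZZpair (m n : int) : ZZ :=
  (\col_(i < 2) if i == 0 then m else n)%R.

Section IntPower.
Variables (G : groupType) (x : G).

Definition expgz (z : Z) : G :=
  match (z : int) with Posz n => x ^+ n | Negz n => x ^- n.+1 end.

Lemma expgz_nat (n : nat) : expgz (n%:Z)%R = x ^+ n. Proof. by []. Qed.

Lemma expgzS (z : int) : expgz (z + 1)%R = expgz z * x.
Proof.
case: z => n; first by rewrite -PoszD addn1 /= -expgSr.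
case: n => [|n]; first by rewrite /= expg1 mulVg.
have -> : (Negz n.+1 + 1 = Negz n)%R by lia.
by rewrite /= [x ^+ n.+2]expgS invgM mulgVK.
Qed.

Lemma expgzB (z : int) : expgz (z - 1)%R = expgz z * x^-1.
Proof. by apply: (@mulIg _ x); rewrite -expgzS mulgVK subrK. Qed.

Lemma expgzD : {morph expgz : a b / a * b}.
Proof.
move=> a b; change (expgz ((a : int) + (b : int))%R = expgz a * expgz b).
elim/int_rect: (b : int) => [|n IH|n IH].
- by rewrite addr0 [expgz 0%R]/expgz /= expg0 mulg1.
- by rewrite -addn1 PoszD addrA !expgzS IH mulgA.
- have -> : (- n.+1%:Z = - n%:Z - 1)%R by lia.
  by rewrite addrA !expgzB IH mulgA.
Qed.

HB.instance Definition _ := isMultiplicative.Build Z G expgz expgzD.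

End IntPower.

Section GL2.

Record GL2Z := MkGL2Z { gl_mx :> 'M[int]_2; _ : gl_mx \in unitmx }.
HB.instance Definition _ := [isSub for gl_mx].
HB.instance Definition _ := [Choice of GL2Z by <:].

Lemma gl_unit (A : GL2Z) : (A : 'M_2) \in unitmx. Proof. by case: A. Qed.

Lemma gl_mul_subproof (A B : GL2Z) : ((A : 'M_2) *m B \in unitmx)%R.
Proof. by rewrite unitmx_mul !gl_unit. Qed.
Lemma gl_inv_subproof (A : GL2Z) : invmx (A : 'M_2) \in unitmx.
Proof. by rewrite unitmx_inv gl_unit. Qed.

Definition gl_one : GL2Z := MkGL2Z (unitmx1 _ _).
Definition gl_mul (A B : GL2Z) : GL2Z := MkGL2Z (gl_mul_subproof A B).
Definition gl_inv (A : GL2Z) : GL2Z := MkGL2Z (gl_inv_subproof A).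

Lemma gl_mulA : associative gl_mul.
Proof. by move=> A B C; apply: val_inj; rewrite /= mulmxA. Qed.
Lemma gl_mul1 : left_id gl_one gl_mul.
Proof. by move=> A; apply: val_inj; rewrite /= mul1mx. Qed.
Lemma gl_mulr1 : right_id gl_one gl_mul.
Proof. by move=> A; apply: val_inj; rewrite /= mulmx1. Qed.
Lemma gl_mulV : left_inverse gl_one gl_inv gl_mul.
Proof. by move=> A; apply: val_inj; rewrite /= mulVmx ?gl_unit. Qed.
Lemma gl_mulrV : right_inverse gl_one gl_inv gl_mul.
Proof. by move=> A; apply: val_inj; rewrite /= mulmxV ?gl_unit. Qed.

HB.instance Definition _ :=
  isGroup.Build GL2Z gl_mulA gl_mul1 gl_mulr1 gl_mulV gl_mulrV.

Lemma mx_aut_subproof (A : GL2Z) :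
  @is_aut ZZ (fun x : 'cV[int]_2 => ((A : 'M_2) *m x)%R).
Proof.
split; first by move=> x y; apply: mulmxDr.
exists (fun x : 'cV[int]_2 => (invmx A *m x)%R) => x.
  by rewrite mulmxA mulVmx ?gl_unit // mul1mx.
by rewrite mulmxA mulmxV ?gl_unit // mul1mx.
Qed.

(* The identification of GL_2(Z) with Aut(Z + Z). *)
Definition mx_aut (A : GL2Z) : aut ZZ := mk_aut (mx_aut_subproof A).

Lemma mx_autM : {morph mx_aut : A B / A * B}.
Proof. by move=> A B; apply: autP => x; rewrite /= mulmxA. Qed.

HB.instance Definition _ := isMultiplicative.Build GL2Z (aut ZZ) mx_aut mx_autM.

Lemma opp_aut_subproof : @is_aut ZZ (fun x : 'cV[int]_2 => (- x)%R).
Proof.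
split; first by move=> x y; apply: opprD.
by exists (fun x : 'cV[int]_2 => (- x)%R) => x; rewrite opprK.
Qed.

Definition opp_aut : aut ZZ := mk_aut opp_aut_subproof.

Definition exceptional (A : GL2Z) : Prop :=
  (\det A = 1 /\ `|\tr A| <= 2)%R \/ (\det A = -1 /\ \tr A = 0)%R.

Definition anosov (A : GL2Z) : Prop := ~ exceptional A.

Lemma det2 (A : 'M[int]_2) : (\det A = A 0 0 * A 1 1 - A 0 1 * A 1 0)%R.
Proof.
rewrite (expand_det_row _ 0%R) !big_ord_recl big_ord0 addr0 /cofactor.
rewrite !det_mx11 !mxE /= expr0 expr1 mul1r mulN1r mulrN.
by congr (A _ _ * A _ _ - A _ _ * A _ _)%R; apply/val_inj.
Qed.

Lemma anosov_det (A : GL2Z) : anosov A -> (\det ((A : 'M_2) - 1%:M) != 0)%R.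
Proof.
move=> hA; have := gl_unit A; rewrite unitmxE.
have E1 : (\det A = A 0 0 * A 1 1 - A 0 1 * A 1 0)%R by rewrite det2.
have E2 : (\tr A = A 0 0 + A 1 1)%R.
  by rewrite /mxtrace !big_ord_recl big_ord0 addr0; congr (_ + A _ _)%R; apply/val_inj.
have E3 : (\det ((A : 'M_2) - 1%:M) = \det A - \tr A + 1)%R.
  by rewrite E1 E2 det2 !mxE /= !mulr0n !mulr1n; ring.
rewrite E3; move: hA; rewrite /anosov /exceptional => hA.
move=> dU; apply/eqP => h0; apply: hA.
have [d1|d1] : (\det A = 1 \/ \det A = -1)%R.
  by move: dU => /orP[] /eqP; [left|right].
- by left; split=> //; have -> : (\tr A = 2)%R by lia.
- by right; split=> //; lia.
Qed.

End GL2.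

(* The isomorphism with Z_2 + Z, realised by an injective f onto the
   centralizer, is the abstract one: f need not be (e, l) |-> (-1)^e M0^l. *)
Definition centralizer_root (A M0 : GL2Z) : Prop :=
  centralizer A = [set B : GL2Z | exists l : int,
      gl_mx B = expgz M0 l \/ gl_mx B = (- gl_mx (expgz M0 l))%R]
  /\ exists f : {multiplicative (Zmod2 * Z)%type -> GL2Z},
       injective f /\ range f = centralizer A.

Definition mx_act (theta : {multiplicative Z -> GL2Z}) :
  {multiplicative Z -> aut ZZ} := mx_aut \o theta.

Definition ZZrtimes (theta : {multiplicative Z -> GL2Z}) : groupType :=
  sdprod (mx_act theta).

Section NaturalMap.
Variable theta : {multiplicative Z -> GL2Z}.
Let A : GL2Z := theta Zgen.
Local Notation E := (ZZrtimes theta).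

Lemma gamma_minus_subproof :
  @is_aut E (fun e => SDPair (opp_aut (sdl e)) (sdr e)).
Proof.
split.
  move=> [x m] [y n]; congr SDPair.
  rewrite /= (opprD (x : 'cV[int]_2)); congr (_ + _)%R.
  by rewrite mulmxN.
exists (fun e : E => SDPair (opp_aut (sdl e)) (sdr e)) => -[x n] /=;
  by rewrite opprK.
Qed.

(* SDPair x n is x * v^n with v = SDPair 1 Zgen, and x is negated. *)
Definition gamma_minus : aut E := mk_aut gamma_minus_subproof.

Hypothesis hA : anosov (theta Zgen).

Local Notation inl := (sdinl (mx_act theta)).
Local Notation inr := (sdinr (mx_act theta)).

(* Z + Z is characteristic in E: as det (A - 1) != 0, a nonzero multiple of
   each of its elements is a commutator, which dies in the quotient Z. *)
Lemma ZZ_char (alpha : aut E) (x : ZZ) : sdr (alpha (inl x)) = 1.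
Proof.
pose f (y : 'cV[int]_2) : int := sdr (alpha (inl y)).
have fD y z : (f (y + z) = f y + f z)%R.
  by rewrite /f -[(y + z)%R]/((y : ZZ) * (z : ZZ))%g sdinlM autM.
have f0 : (f 0 = 0)%R by apply: (@addrI _ (f 0%R)); rewrite -fD !addr0.
have fN y : (f (- y) = - f y)%R.
  by apply: (@addrI _ (f y)); rewrite -fD !subrr.
have fB : zmod_morphism f by move=> y z; rewrite fD fN.
pose F := GRing.isZmodMorphism.Build _ _ f fB.
pose fa : {additive 'cV[int]_2 -> int} := HB.pack f F.
have fA (y : 'cV[int]_2) : f ((A : 'M_2) *m y)%R = f y.
  have /(congr1 (fun e => sdr (alpha e))) :=
    sdinlJ (mx_act theta) Zgen (y : ZZ).
  rewrite !autM !sdrM => E1.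
  apply: (@addrI _ (sdr (alpha (inr Zgen)) : int)).
  by rewrite [LHS]addrC; symmetry; exact: E1.
pose k := (\det ((A : 'M_2) - 1%:M))%R.
have : (f (k *: x) = 0)%R.
  rewrite -mul_scalar_mx -mul_mx_adj -mulmxA mulmxBl mul1mx.
  by rewrite fB fA subrr.
have fMz : (f (x *~ k) = f x *~ k)%R := raddfMz fa k x.
rewrite -[k]intz scaler_int fMz -mulrzr intz.
move/eqP; rewrite mulf_eq0 => /orP[/eqP //|/eqP k0].
by have := anosov_det hA; rewrite -/k k0.
Qed.

Definition restr_fun (alpha : aut E) (x : ZZ) : ZZ := sdl (alpha (inl x)).
Definition quot_fun (alpha : aut E) (n : Z) : Z := sdr (alpha (inr n)).

Lemma restr_funE alpha x : inl (restr_fun alpha x) = alpha (inl x).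
Proof.
by have := ZZ_char alpha x; rewrite /restr_fun; case: (alpha _) => y n /= ->.
Qed.

Lemma quot_funE alpha e : quot_fun alpha (sdr e) = sdr (alpha e).
Proof.
by rewrite [in RHS](sdprodE e) autM sdrM ZZ_char mul1g.
Qed.

Lemma sdinl_inj : injective inl. Proof. by move=> x y []. Qed.

Lemma restr_fun_aut alpha : is_aut (restr_fun alpha).
Proof.
split.
  by move=> x y; apply: sdinl_inj; rewrite restr_funE !sdinlM autM !restr_funE.
by exists (restr_fun alpha^-1) => x; apply: sdinl_inj;
  rewrite !restr_funE ?autK ?autVK.
Qed.

Lemma quot_fun_aut alpha : is_aut (quot_fun alpha).
Proof.
split.
  move=> m n; rewrite -[m]/(sdr (inr m)) -[n]/(sdr (inr n)) -sdrM.
  by rewrite !quot_funE autM.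
by exists (quot_fun alpha^-1) => n; rewrite -[n in LHS]/(sdr (inr n));
  rewrite !quot_funE ?autK ?autVK.
Qed.

(* The induced automorphism of the quotient, identified with Z by sdr, and the
   restriction to Z + Z: see psi_fstE and psi_sndE. *)
Definition psi (alpha : aut E) : (aut Z * aut ZZ)%type :=
  (mk_aut (quot_fun_aut alpha), mk_aut (restr_fun_aut alpha)).

Lemma psi_fstE alpha e : (psi alpha).1 (sdr e) = sdr (alpha e).
Proof. exact: quot_funE. Qed.

Lemma psi_sndE alpha x : inl ((psi alpha).2 x) = alpha (inl x).
Proof. exact: restr_funE. Qed.

Lemma psiM : {morph psi : a b / a * b}.
Proof.
move=> a b; congr pair; apply: autP => x.
  rewrite mulautE; change (quot_fun (a * b) x = quot_fun a (quot_fun b x)).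
  by rewrite -[x]/(sdr (inr x)) !quot_funE.
by apply: sdinl_inj; rewrite mulautE !psi_sndE.
Qed.

HB.instance Definition _ :=
  isMultiplicative.Build (aut E) (aut Z * aut ZZ)%type psi psiM.

Definition in_Aut0 : {pred aut E} := [pred alpha | (psi alpha).1 == 1].
Definition Aut0 := {alpha : aut E | in_Aut0 alpha}.

Lemma Aut0_closed : group_closed in_Aut0.
Proof.
have psi1 : psi 1 = 1 by apply: (@mulgI _ (psi 1)); rewrite -psiM !mulg1.
have in0E a : reflect ((psi a).1 = 1) (a \in in_Aut0) by exact: eqP.
split; first by apply/in0E; rewrite psi1.
move=> a b /in0E a1 /in0E b1; apply/in0E.
have := congr1 fst (psiM (a / b) b).
by rewrite mulgVK a1 [X in _ = _ * X]b1 mulg1.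
Qed.

HB.instance Definition _ := SubChoice.on Aut0.
HB.instance Definition _ :=
  SubChoice_isSubGroup.Build (aut E) in_Aut0 Aut0 Aut0_closed.

End NaturalMap.

(* Main.v *)
Require Import Defs.
From HB Require Import structures.
From mathcomp Require Import all_boot all_order all_algebra.
From mathcomp Require Import boolp classical_sets.
From mathcomp Require Import zify.

Set Implicit Arguments.
Unset Strict Implicit.
Unset Printing Implicit Defensive.

Import GRing.Theory.

Local Open Scope group_scope.
Local Open Scope classical_set_scope.

(** Write A for theta(1). An automorphism alpha of E lying over the identity of
    the quotient Z is determined by its restriction f to Z + Z and by
    alpha(v) = c v with c in Z + Z. The relation v x v^-1 = A x forces f to
    commute with A, and conversely every such pair (c, f) comes from the
    automorphism (x, n) |-> f(x) (c v)^n ([affine_aut], [psi_commute],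
    [affine_of_aut]). Composition reads (c, f)(c', f') = (c + f c', f f'), so
    Aut_0(E) is the group of affine maps of Z + Z whose linear part lies in the
    centralizer {+- M0^l} of A ([centralizer_aut]). The maps with linear part
    a power of M0 form the kernel (Z + Z) x| Z ([incl]), and negation, realised
    by gamma_-, supplies the complement Z/2.

    For this decomposition the sign of +- M0^l has to be well defined and
    l |-> M0^l has to be injective. Both follow from M0 having infinite order
    ([root_infinite]): if the involution -1 were a power of M0, then M0 would
    have finite order. Abstractly, when x is a nontrivial involution commuting
    with an element y of infinite order, (z, l) |-> x^z y^l is an isomorphism
    from Z/2 x Z onto the subgroup generated by x and y ([word_inj],
    [generated_word]), and the homomorphism to Z/2 is its first coordinate
    ([ex_parity]). The final identification with a semidirect product is the
    usual one for split extensions ([split_exact_sdprod]). *)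

(** * Homomorphisms and integer powers *)

Section Homomorphisms.
Variables G H : groupType.

Lemma hom1 (f : {multiplicative G -> H}) : f 1 = 1.
Proof. by apply: (@mulgI _ (f 1)); rewrite -gmulfM !mulg1. Qed.

Lemma homV (f : {multiplicative G -> H}) x : f x^-1 = (f x)^-1.
Proof. by apply: (@mulIg _ (f x)); rewrite -gmulfM !mulVg hom1. Qed.

Lemma hom_inj (f : {multiplicative G -> H}) :
  (forall x, f x = 1 -> x = 1) -> injective f.
Proof.
move=> f1 x y fxy; apply: (@mulIg _ y^-1); rewrite mulgV.
by apply: f1; rewrite gmulfM homV fxy mulgV.
Qed.

Lemma range_closed (f : {multiplicative G -> H}) :
  group_closed (mem (range f)).
Proof.
split; first by rewrite inE; exists 1; rewrite ?hom1.
move=> _ _ /set_mem[x _ <-] /set_mem[y _ <-]; rewrite inE.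
by exists (x / y); rewrite ?gmulfM ?homV.
Qed.

End Homomorphisms.

Lemma hom_expgz (G : groupType) (f : {multiplicative Z -> G}) (n : Z) :
  f n = expgz (f Zgen) n.
Proof.
have fS (m : int) : f (m + 1)%R = f m * f Zgen by rewrite -gmulfM.
elim/int_rect: (n : int) => [|k IH|k IH].
- by rewrite -[RHS](_ : 1 = _) // (hom1 f).
- by rewrite -addn1 PoszD fS IH expgzS.
- have -> : (- k.+1%:Z = - k%:Z - 1)%R by lia.
  by apply: (@mulIg _ (f Zgen)); rewrite -fS expgzB mulgVK subrK.
Qed.

Lemma expgz_gen (n : Z) : expgz Zgen n = n.
Proof. by rewrite -(hom_expgz idfun). Qed.

Section PowersOfOneElement.
Variable G : groupType.
Implicit Types (x y : G) (m n : Z).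

Lemma expgz_oneg n : expgz (1 : G) n = 1.
Proof. by case: (n : int) => k; rewrite /= expg1n ?invg1. Qed.

Lemma expgzC x m n : expgz (expgz x m) n = expgz (expgz x n) m.
Proof.
suff E a b : expgz (expgz x a) b = expgz x ((a : int) * (b : int))%R.
  by rewrite !E mulrC.
elim/int_rect: (b : int) => [|k IH|k IH].
- by rewrite mulr0.
- by rewrite -addn1 PoszD expgzS IH mulrDr mulr1 (expgzD x).
- have -> : (- k.+1%:Z = - k%:Z - 1)%R by lia.
  by rewrite expgzB IH mulrBr mulr1 (expgzD x) -(homV (expgz x)).
Qed.

Lemma commute_expgz x y n : commute x y -> commute x (expgz y n).
Proof.
by move=> xy; case: (n : int) => k; rewrite /expgz;
  [|apply: commuteV]; apply: commuteX.
Qed.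

Lemma gmulf_expgz (H : groupType) (f : {multiplicative G -> H}) x n :
  f (expgz x n) = expgz (f x) n.
Proof. by rewrite -[LHS]/((f \o expgz x) n) hom_expgz /= expg1. Qed.

Lemma mem_expgz (S : set G) x n :
  group_closed (mem S) -> S x -> S (expgz x n).
Proof.
move=> Sgp Sx; have SX k : x ^+ k \in S.
  elim: k => [|k IH]; first by rewrite expg0; case: Sgp.
  by rewrite expgS; apply: (group_closedM Sgp) => //; rewrite inE.
apply: set_mem; case: (n : int) => k; first exact: SX.
exact/(group_closedV Sgp)/SX.
Qed.

(** An element of Z/2 is used as the natural number 0 or 1; this makes z |-> x^z
    a homomorphism exactly when x has order dividing 2. *)
Definition expZ2 x (z : Zmod2) : G := x ^+ (z : 'I_2).

Lemma Zmod2P (P : Zmod2 -> Prop) : P 1 -> P Zmod2gen -> forall z, P z.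
Proof.
move=> P0 P1 [[|[|//]] z]; [move: P0 | move: P1];
  by congr P; apply: val_inj.
Qed.

Lemma expZ2_0 x : expZ2 x 1 = 1. Proof. exact: expg0. Qed.
Lemma expZ2_gen x : expZ2 x Zmod2gen = x. Proof. exact: expg1. Qed.
Lemma Zmod2genK : Zmod2gen * Zmod2gen = 1. Proof. exact: val_inj. Qed.

Lemma expZ2M x : x * x = 1 -> {morph expZ2 x : a b / a * b}.
Proof.
move=> xx; apply: Zmod2P => b; first by rewrite expZ2_0 !mul1g.
move: b; apply: Zmod2P; first by rewrite expZ2_0 !mulg1.
by rewrite Zmod2genK expZ2_0 expZ2_gen xx.
Qed.

End PowersOfOneElement.

Section InvolutionHom.
Variables (G : groupType) (x : G) (xx : x * x = 1).

(** The proof of x * x = 1 is kept as a parameter of the function, so that the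
    homomorphism structure can be attached to it. *)
Definition involution_hom_fun of x * x = 1 : Zmod2 -> G := expZ2 x.

HB.instance Definition _ :=
  isMultiplicative.Build Zmod2 G (involution_hom_fun xx) (expZ2M xx).

Definition involution_hom : {multiplicative Zmod2 -> G} :=
  involution_hom_fun xx.

End InvolutionHom.

(** * The subgroup generated by an involution and a commuting element *)

Section GeneratedByInvolution.
Variables (G : groupType) (x y : G).
Hypotheses (xx : x * x = 1) (x1 : x <> 1) (xy : commute x y).
Hypothesis y_inf : injective (expgz y).

Definition word (zl : (Zmod2 * Z)%type) : G := expZ2 x zl.1 * expgz y zl.2.

Lemma wordM : {morph word : a b / a * b}.
Proof.
move=> [z l] [w k]; rewrite /word /= expZ2M // (expgzD y) -!mulgA.
congr (_ * _); rewrite !mulgA; congr (_ * _).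
by apply: commute_expgz; apply: commute_sym; apply: commuteX.
Qed.

HB.instance Definition _ :=
  isMultiplicative.Build (Zmod2 * Z)%type G word wordM.

(** If x^z y^l = 1 then squaring removes the involution and leaves y^(2l) = 1,
    hence l = 0, and then z = 0 because x is nontrivial. *)
Lemma word_inj : injective word.
Proof.
apply: hom_inj => -[z l] zl1.
have l0 : l = 1.
  have : word ((z, l) * (z, l)) = 1 by rewrite gmulfM zl1 mulg1.
  have -> : (z, l) * (z, l) = (1, l * l) :> (Zmod2 * Z)%type.
    by congr pair; move: z {zl1}; apply: Zmod2P; rewrite ?Zmod2genK ?mulg1.
  rewrite /word /= expZ2_0 mul1g => ll.
  have /y_inf : expgz y (l * l) = expgz y 1 by [].
  by rewrite -[l * l]/((l : int) + (l : int))%R -[1]/(0%R : int); lia.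
move: zl1; rewrite l0 => {l0}; move: z; apply: Zmod2P => //.
suff /= -> : word (Zmod2gen, 1) = x by [].
by rewrite /word expZ2_gen mulg1.
Qed.

Lemma generated_word : generated [set y; x] = range word.
Proof.
apply/seteqP; split=> g.
  apply; split; first exact: (range_closed word).
  move=> _ [->|->]; [exists (1, Zgen)|exists (Zmod2gen, 1)] => //.
    by rewrite /word /= expZ2_0 expg1 mul1g.
  by rewrite /word /= expZ2_gen mulg1.
move=> [[z l] _ <-] S [Sgp Sxy].
have /set_mem// : word (z, l) \in S.
apply: (group_closedM Sgp); rewrite inE; last first.
  by apply: mem_expgz => //; apply: Sxy; left.
move: z; apply: Zmod2P; rewrite ?expZ2_0 ?expZ2_gen; last by apply: Sxy; right.
by apply/set_mem; case: Sgp.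
Qed.

(** Being the exponent of x in the word x^z y^l, chi is multiplicative on the
    subgroup generated by x and y. *)
Lemma ex_parity :
  exists chi : G -> Zmod2, forall zl, chi (word zl) = zl.1.
Proof.
exists (fun g => if pselect (exists zl, word zl = g) is left e
                 then (sval (cid e)).1 else 1) => zl.
case: pselect => [e|]; last by case; exists zl.
by case: cid => /= w /word_inj->.
Qed.

End GeneratedByInvolution.

(** * Split extensions *)

Lemma inj_surj_bij (N G : Type) (f : N -> G) :
  injective f -> range f = setT -> bijective f.
Proof.
move=> finj fsurj.
have fex g : exists x, f x = g.
  have : [set: G] g by [].
  by rewrite -fsurj => -[x _ <-]; exists x.
by exists (fun g => sval (cid (fex g))) => g; case: cid => //= x; exact: finj.
Qed.

Lemma split_exact_sdprod (N G Q : groupType)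
    (i : {multiplicative N -> G}) (p : {multiplicative G -> Q})
    (s : {multiplicative Q -> G}) (phi : {multiplicative Q -> aut N}) :
  short_exact i p -> cancel s p ->
  (forall z g, s z * i g * (s z)^-1 = i (phi z g)) ->
  exists f : {multiplicative sdprod phi -> G},
    bijective f /\ forall g z, f (SDPair g z) = i g * s z.
Proof.
move=> [i_inj i_p _] sK sJ.
pose f (u : sdprod phi) := i (sdl u) * s (sdr u).
have fM : {morph f : u v / u * v}.
  move=> [g z] [h w]; rewrite /f /= !gmulfM -sJ.
  by rewrite !mulgA mulgVK.
have pi g : p (i g) = 1 by have : range i (i g) by []; rewrite i_p.
pose F : {multiplicative sdprod phi -> G} :=
  HB.pack f (isMultiplicative.Build _ _ f fM).
exists F; split=> //; apply: inj_surj_bij.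
  apply: hom_inj => -[g z] /= ; rewrite /f /= => fgz.
  have z1 : z = 1.
    by have := congr1 p fgz; rewrite gmulfM pi mul1g sK hom1.
  move: fgz; rewrite z1 hom1 mulg1 -(hom1 i) => /i_inj->.
  by [].
apply/seteqP; split=> // g _.
have [n _ ni] : range i (g * (s (p g))^-1).
  by rewrite i_p /= gmulfM homV sK mulgV.
by exists (SDPair n (p g)); rewrite //= /f /= ni mulgVK.
Qed.

(** * Automorphisms of Z + Z and the centralizer *)

Lemma mx_aut_inj : injective mx_aut.
Proof.
move=> A B AB; apply/val_inj/matrixP => i j.
have /(congr1 (fun c : 'cV[int]_2 => c i 0%R)) :
    mx_aut A (delta_mx j 0)%R = mx_aut B (delta_mx j 0)%R by rewrite AB.
by rewrite /= -!colE !mxE.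
Qed.

Lemma additive_mulmx (f : aut ZZ) :
  exists A : 'M[int]_2, forall x : 'cV[int]_2, f x = (A *m x)%R.
Proof.
have fD (x y : 'cV[int]_2) : f (x + y)%R = (f x + f y)%R :> 'cV[int]_2.
  exact: (autM f).
have f0 : f 0%R = 0%R :> 'cV[int]_2 by exact: (aut1 f).
have fN (x : 'cV[int]_2) : f (- x)%R = (- (f x : 'cV[int]_2))%R.
  by apply: (@GRing.addrI _ (f x)); rewrite -fD !GRing.subrr.
have fB : zmod_morphism (f : 'cV[int]_2 -> 'cV[int]_2).
  by move=> x y; rewrite fD fN.
pose fa : {additive 'cV[int]_2 -> 'cV[int]_2} :=
  HB.pack (f : 'cV[int]_2 -> 'cV[int]_2)
    (GRing.isZmodMorphism.Build _ _ (f : 'cV[int]_2 -> 'cV[int]_2) fB).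
exists (\matrix_(i, j) (fa (delta_mx j 0)) i 0)%R => x.
rewrite -[LHS]/(fa x) {1}[x]matrix_sum_delta raddf_sum.
apply/colP => i; rewrite summxE !mxE; apply: eq_bigr => j _.
rewrite big_ord1 -[x j 0%R]intz scaler_int raddfMz -scaler_int intz !mxE.
by rewrite mulrC.
Qed.

Lemma mx_aut_surj (f : aut ZZ) : exists A, mx_aut A = f.
Proof.
have [A fA] := additive_mulmx f; have [B fB] := additive_mulmx f^-1.
have AB : (A *m B = 1%:M)%R.
  apply/matrixP => i j; rewrite -[LHS]mulr1.
  have /(congr1 (fun c : 'cV[int]_2 => c i 0%R)) :
      (A *m (B *m delta_mx j 0) = delta_mx j 0 :> 'cV[int]_2)%R.
    by rewrite -fB -fA; exact: (autVK f (delta_mx j 0)%R).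
  by rewrite mulmxA -colE !mxE mulr1 eqxx andbT.
have [Au _] := mulmx1_unit AB.
by exists (MkGL2Z Au); apply: autP => x; rewrite fA.
Qed.

Lemma opp_autK : opp_aut * opp_aut = 1.
Proof. by apply: autP => x; apply: opprK. Qed.

Lemma opp_aut_neq1 : opp_aut <> 1.
Proof.
move/(congr1 (fun f : aut ZZ => (f (ZZpair 1 1) : 'cV[int]_2) 0%R 0%R)).
by rewrite /= !mxE.
Qed.

Lemma opp_aut_commute (f : aut ZZ) : commute opp_aut f.
Proof.
apply: autP => x; symmetry; exact: (homV f).
Qed.

Section Centralizer.
Variables A M0 : GL2Z.
Hypothesis hM0 : centralizer_root A M0.

Lemma root_commute n : commute A (expgz M0 n).
Proof.
have : centralizer A (expgz M0 n) by rewrite hM0.1; exists n; left.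
by [].
Qed.

(** M0 having finite order would make the centralizer finite. Concretely, the
    generator g = f (0, 1) of the factor Z of the centralizer is +- M0^l, so
    g^2 = M0^(2l) whatever the sign; thus M0^k = 1 gives g^(2k) = 1
    and k = 0. *)
Lemma root_infinite : injective (expgz M0).
Proof.
apply: hom_inj => k M0k.
have [cA [f [f_inj f_im]]] := hM0.
have [l gE] : exists l, f (1, Zgen) = expgz M0 l \/
    mx_aut (f (1, Zgen)) = opp_aut * mx_aut (expgz M0 l).
  have : centralizer A (f (1, Zgen)) by rewrite -f_im; exists (1, Zgen).
  rewrite cA => -[l [fl|fl]]; exists l; [left; exact: val_inj|right].
  by apply: autP => x; rewrite /= fl mulNmx.
have g2 : f (1, Zgen) * f (1, Zgen) = expgz M0 (l * l).
  case: gE => [->|gE]; first by rewrite (expgzD M0).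
  apply: mx_aut_inj; rewrite (expgzD M0) !mx_autM gE mulgA.
  by rewrite -(mulgA opp_aut) -opp_aut_commute mulgA opp_autK mul1g.
(* g n is the 2n-th power of the generator; doubling n removes the sign *)
pose g (n : Z) := f (1, n * n).
have gM : {morph g : a b / a * b}.
  move=> a b; rewrite /g -gmulfM; congr (f _); congr pair.
    by rewrite mulg1.
  exact: (@addrACA int).
have : f (1, k * k) = 1.
  pose gh : {multiplicative Z -> GL2Z} :=
    HB.pack g (isMultiplicative.Build _ _ g gM).
  rewrite -[LHS]/(gh k) hom_expgz /= /g.
  have -> : (1, Zgen * Zgen) = (1, Zgen) * (1, Zgen) :> (Zmod2 * Z)%type.
    by congr pair; rewrite mulg1.
  by rewrite gmulfM g2 expgzC M0k expgz_oneg.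
rewrite -(hom1 f) => /f_inj[].
rewrite -[k * k]/((k : int) + (k : int))%R -[1 : Z]/(0%R : int) => kk.
by have : (k : int) = 0%R by lia.
Qed.

Lemma centralizer_aut (f : aut ZZ) : commute (mx_aut A) f ->
  exists z n, f = expZ2 opp_aut z * mx_aut (expgz M0 n).
Proof.
have [B <-] := mx_aut_surj f; rewrite /commute -!gmulfM => /mx_aut_inj AB.
have : centralizer A B by [].
rewrite hM0.1 => -[n [Bn|Bn]].
  exists 1, n; rewrite expZ2_0 mul1g; congr mx_aut; exact: val_inj.
exists Zmod2gen, n; rewrite expZ2_gen.
by apply: autP => x; rewrite /= Bn mulNmx.
Qed.

End Centralizer.

(** * Automorphisms of E over the identity of Z *)

Lemma aut_expgz (G : groupType) (f : aut G) x n :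
  f (expgz x n) = expgz (f x) n.
Proof. exact: (gmulf_expgz f). Qed.

Section AutomorphismsOverTheIdentity.
Variable theta : {multiplicative Z -> GL2Z}.
Local Notation A := (theta Zgen).
Local Notation E := (ZZrtimes theta).
Local Notation inl := (sdinl (mx_act theta)).
Local Notation inr := (sdinr (mx_act theta)).

Lemma sdprod_ext (u v : E) : sdl u = sdl v -> sdr u = sdr v -> u = v.
Proof. by case: u v => x m [y n] /= -> ->. Qed.

Lemma sdinl_mul (x : ZZ) (u : E) :
  inl x * u = SDPair (x * sdl u) (sdr u).
Proof.
by apply: sdprod_ext; rewrite ?sdlM ?(hom1 (mx_act theta)) ?sdrM ?mul1g.
Qed.

(** As Z + Z is abelian, conjugation by u on it depends only on the image of u
    in Z. *)
Lemma mul_sdinl (u : E) (x : ZZ) :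
  u * inl x = inl (mx_act theta (sdr u) x) * u.
Proof.
rewrite sdinl_mul; congr SDPair; last by rewrite mulg1.
exact: (@addrC 'cV[int]_2).
Qed.

Lemma sdinr_expgz (n : Z) : inr n = expgz (inr Zgen) n.
Proof.
have rM : {morph inr : a b / a * b}.
  by move=> a b; apply: sdprod_ext; rewrite ?sdlM ?sdrM ?aut1 ?mulg1.
pose r : {multiplicative Z -> E} :=
  HB.pack inr (isMultiplicative.Build _ _ inr rM).
exact: (hom_expgz r).
Qed.

Lemma sdr_expgz (u : E) (n : Z) : sdr (expgz u n) = expgz (sdr u) n.
Proof.
pose r : {multiplicative E -> Z} :=
  HB.pack (sdr : E -> Z)
    (isMultiplicative.Build _ _ (sdr : E -> Z) (@sdrM _ _ _)).
exact: (gmulf_expgz r).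
Qed.

Lemma commute_mx_act f (n : Z) : commute (mx_aut A) f ->
  commute f (mx_act theta n).
Proof.
move=> Af; rewrite (hom_expgz (mx_act theta)).
exact/commute_expgz/commute_sym.
Qed.

Lemma aut_ext (f g : aut E) :
  (forall x, f (inl x) = g (inl x)) -> f (inr Zgen) = g (inr Zgen) -> f = g.
Proof.
move=> fgl fgr; apply: autP => u.
rewrite (sdprodE u) !autM fgl sdinr_expgz; congr (_ * _).
by rewrite !aut_expgz fgr.
Qed.

Section Affine.
Variables (c : ZZ) (f : aut ZZ).
Hypothesis Af : commute (mx_aut A) f.

(** Since u = x v^n in E, this formula is forced on an automorphism restricting
    to f on Z + Z and sending v to c v. *)
Definition affine_fun (u : E) : E :=
  inl (f (sdl u)) * expgz (SDPair c Zgen) (sdr u).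

Lemma affine_funE u : affine_fun u =
  SDPair (f (sdl u) * sdl (expgz (SDPair c Zgen : E) (sdr u))) (sdr u).
Proof. by rewrite /affine_fun sdinl_mul sdr_expgz expgz_gen. Qed.

(** Multiplicativity needs (c v)^n to act on Z + Z as v^n does, and f to commute
    with this action. *)
Lemma affine_aut_subproof : is_aut affine_fun.
Proof.
split=> [u v|].
  rewrite /affine_fun sdlM sdrM autM sdinlM (expgzD (SDPair c Zgen)).
  rewrite -mulautE commute_mx_act // mulautE -!mulgA; congr (_ * _).
  rewrite !mulgA; congr (_ * _).
  by rewrite mul_sdinl sdr_expgz expgz_gen.
pose w n := sdl (expgz (SDPair c Zgen : E) n).
exists (fun u => SDPair (f^-1 (sdl u * (w (sdr u))^-1)) (sdr u)) => -[x n];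
  rewrite affine_funE; cbn [sdl sdr]; first by rewrite mulgK autK.
by rewrite autVK mulgVK.
Qed.

Definition affine_aut : aut E := mk_aut affine_aut_subproof.

Lemma affine_autl x : affine_aut (inl x) = inl (f x).
Proof. by rewrite /= /affine_fun mulg1. Qed.

Lemma affine_autr : affine_aut (inr Zgen) = SDPair c Zgen.
Proof. by rewrite /= /affine_fun /= aut1 mul1g expg1. Qed.

End Affine.

Lemma gamma_minus_inl x : gamma_minus theta (inl x) = inl (opp_aut x).
Proof. by []. Qed.

Lemma gamma_minus_inr : gamma_minus theta (inr Zgen) = inr Zgen.
Proof. by congr SDPair; exact: oppr0. Qed.

Lemma gamma_minusK : gamma_minus theta * gamma_minus theta = 1.
Proof. by apply: autP => -[x n] /=; rewrite opprK. Qed.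

Hypothesis hA : anosov A.

Lemma psi_eq (alpha : aut E) (f : aut Z) (g : aut ZZ) :
  (forall u, sdr (alpha u) = f (sdr u)) ->
  (forall x, alpha (inl x) = inl (g x)) -> psi hA alpha = (f, g).
Proof.
move=> af ag; rewrite [LHS]surjective_pairing; congr pair; apply: autP => x.
  by rewrite -[x]/(sdr (inr x)) psi_fstE af.
by apply: (@sdinl_inj theta); rewrite psi_sndE.
Qed.

Lemma psi_affine c f (Af : commute (mx_aut A) f) :
  psi hA (affine_aut c Af) = (1, f).
Proof.
apply: psi_eq => [u|x]; last exact: affine_autl.
by rewrite -[LHS]/(sdr (affine_fun c f u)) affine_funE.
Qed.

Lemma psi_gamma_minus : psi hA (gamma_minus theta) = (1, opp_aut).
Proof. exact: psi_eq. Qed.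

(** Apply alpha to the relation v x v^-1 = A x, and use that alpha(v) acts on
    Z + Z as v does. *)
Lemma psi_commute (alpha : aut E) : (psi hA alpha).1 = 1 ->
  commute (mx_aut A) (psi hA alpha).2.
Proof.
move=> a1; apply: autP => x; apply: (@sdinl_inj theta).
have rgen : sdr (alpha (inr Zgen)) = Zgen by rewrite -(psi_fstE hA) a1.
rewrite !mulautE psi_sndE.
apply: (@mulIg _ (alpha (inr Zgen))).
have := congr1 alpha (sdinlJ (mx_act theta) Zgen x).
by rewrite !autM => <-; rewrite -psi_sndE mul_sdinl rgen.
Qed.

Lemma affine_of_aut (alpha : aut E) f (Af : commute (mx_aut A) f) :
  psi hA alpha = (1, f) ->
  alpha = affine_aut (sdl (alpha (inr Zgen))) Af.
Proof.
move=> af; apply: aut_ext => [x|].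
  by rewrite affine_autl -(psi_sndE hA) af.
rewrite affine_autr; have : sdr (alpha (inr Zgen)) = Zgen.
  by rewrite -(psi_fstE hA) af.
by case: (alpha _) => c n /= ->.
Qed.

End AutomorphismsOverTheIdentity.

(** * The structure of Aut_0(E) *)

Section StructureOfAut0.
Variables (theta : {multiplicative Z -> GL2Z}) (M0 : GL2Z).
Local Notation A := (theta Zgen).
Hypotheses (hA : anosov A) (hM0 : centralizer_root A M0).
Local Notation E := (ZZrtimes theta).
Local Notation N := (ZZrtimes (expgz M0)).
Local Notation inl := (sdinl (mx_act theta)).
Local Notation inr := (sdinr (mx_act theta)).

Local Notation negation := ((1, opp_aut) : (aut Z * aut ZZ)%type).
Local Notation root := ((1, mx_aut M0) : (aut Z * aut ZZ)%type).

Lemma negationK : negation * negation = 1.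
Proof. by congr pair; rewrite ?mulg1 ?opp_autK. Qed.

Lemma negation_neq1 : negation <> 1.
Proof. by move/(congr1 snd); exact: opp_aut_neq1. Qed.

Lemma negation_commute : commute negation root.
Proof. by congr pair; exact: opp_aut_commute. Qed.

Lemma root_expgz n : expgz root n = (1, mx_aut (expgz M0 n)).
Proof.
have pM : {morph (fun B : GL2Z => (1, mx_aut B) : (aut Z * aut ZZ)%type) :
    B C / B * C}.
  by move=> B C; congr pair; [rewrite mulg1 | exact: mx_autM].
pose p : {multiplicative GL2Z -> (aut Z * aut ZZ)%type} :=
  HB.pack (fun B : GL2Z => (1, mx_aut B) : (aut Z * aut ZZ)%type)
    (isMultiplicative.Build _ _ _ pM).
by rewrite -[LHS](gmulf_expgz p).
Qed.

Lemma root_inj : injective (expgz root).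
Proof.
move=> m n; rewrite !root_expgz => /(congr1 snd)/mx_aut_inj.
exact: (root_infinite hM0).
Qed.

Lemma root_act_commute n : commute (mx_aut A) (mx_act (expgz M0) n).
Proof. exact/gmulf_commute/(root_commute hM0). Qed.

Lemma Aut0_of_subproof alpha f : psi hA alpha = (1, f) -> in_Aut0 hA alpha.
Proof. by move=> af; apply/eqP; rewrite af. Qed.

Definition Aut0_of alpha f (af : psi hA alpha = (1, f)) : Aut0 hA :=
  exist _ alpha (Aut0_of_subproof af).

Definition incl_fun (g : N) : Aut0 hA :=
  Aut0_of (psi_affine hA (sdl g) (root_act_commute (sdr g))).

Lemma incl_funl g x :
  val (incl_fun g) (inl x) = inl (mx_act (expgz M0) (sdr g) x).
Proof. exact: affine_autl. Qed.

Lemma incl_funr g : val (incl_fun g) (inr Zgen) = SDPair (sdl g) Zgen.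
Proof. exact: affine_autr. Qed.

Lemma psi_incl_fun g : psi hA (val (incl_fun g)) = expgz root (sdr g).
Proof. by rewrite psi_affine root_expgz. Qed.

Lemma incl_funM : {morph incl_fun : g h / g * h}.
Proof.
move=> g h; apply: val_inj; apply: aut_ext => [x|].
  rewrite incl_funl sdrM (@gmulfM _ _ (mx_act (expgz M0))).
  by rewrite -[RHS]/(val (incl_fun g) (val (incl_fun h) (inl x))) !incl_funl.
rewrite incl_funr.
rewrite -[RHS]/(val (incl_fun g) (val (incl_fun h) (inr Zgen))) incl_funr.
rewrite (sdprodE (SDPair (sdl h) Zgen)) autM incl_funl incl_funr sdinl_mul.
congr SDPair; exact: (@addrC 'cV[int]_2).
Qed.

HB.instance Definition _ :=
  isMultiplicative.Build N (Aut0 hA) incl_fun incl_funM.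

Definition incl : {multiplicative N -> Aut0 hA} := incl_fun.

Lemma incl_inj : injective incl.
Proof.
move=> g h gh; apply: sdprod_ext.
  by have := incl_funr h; rewrite -[incl_fun h]gh incl_funr => -[].
by apply: root_inj; rewrite -!psi_incl_fun -[incl_fun h]gh.
Qed.

Definition gamma0 : Aut0 hA := Aut0_of (psi_gamma_minus hA).

Lemma gamma0K : gamma0 * gamma0 = 1.
Proof. by apply: val_inj; exact: gamma_minusK. Qed.

Definition splitting := involution_hom gamma0K.

(** Conjugating (c, M0^t) by negation gives (-c, M0^t), which is the map
    gamma_- of the group (Z + Z) x|_M0 Z itself. *)
Definition split_action := involution_hom (gamma_minusK (expgz M0)).

Lemma splitting_incl z g :
  splitting z * incl g * (splitting z)^-1 = incl (split_action z g).
Proof.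
apply: (@mulIg _ (splitting z)); rewrite mulgVK.
move: z; apply: Zmod2P.
  by rewrite (hom1 splitting) (hom1 split_action) mulg1 mul1g.
rewrite -[splitting _]/(expZ2 gamma0 Zmod2gen) expZ2_gen.
rewrite -[split_action _]/(expZ2 (gamma_minus (expgz M0)) Zmod2gen) expZ2_gen.
apply: val_inj; apply: aut_ext => [x|].
  rewrite -[LHS]/(gamma_minus theta (val (incl_fun g) (inl x))).
  rewrite -[RHS]/(val (incl_fun (gamma_minus (expgz M0) g))
    (gamma_minus theta (inl x))).
  rewrite gamma_minus_inl !incl_funl gamma_minus_inl.
  by rewrite -!mulautE opp_aut_commute.
rewrite -[LHS]/(gamma_minus theta (val (incl_fun g) (inr Zgen))).
rewrite -[RHS]/(val (incl_fun (gamma_minus (expgz M0) g))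
    (gamma_minus theta (inr Zgen))).
by rewrite gamma_minus_inr !incl_funr.
Qed.

Lemma psi_Aut0 (alpha : aut E) : (psi hA alpha).1 = 1 ->
  exists zn, psi hA alpha = word negation root zn.
Proof.
move=> a1; have [z [n an]] := centralizer_aut hM0 (psi_commute a1).
exists (z, n); rewrite /word root_expgz [LHS]surjective_pairing a1 an.
by move: z {an}; apply: Zmod2P; rewrite ?expZ2_0 ?expZ2_gen;
  congr pair; rewrite ?mul1g.
Qed.

Lemma psi_word zn : exists alpha : Aut0 hA,
  psi hA (val alpha) = word negation root zn.
Proof.
case: zn => z n; exists (splitting z * incl (SDPair 1 n)).
rewrite [LHS](psiM hA) psi_incl_fun; congr (_ * _).
move: z; apply: Zmod2P; first by rewrite (hom1 splitting) (hom1 (psi hA)).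
rewrite -[splitting _]/(expZ2 gamma0 Zmod2gen) !expZ2_gen.
exact: psi_gamma_minus.
Qed.

Lemma range_psi :
  range (psi hA) `&` [set q | q.1 = 1] =
  range (word negation root).
Proof.
apply/seteqP; split=> q.
  move=> [[alpha _ <-] a1]; have [zn ->] := psi_Aut0 a1; by exists zn.
move=> [zn _ <-]; have [alpha <-] := psi_word zn.
split; first by exists (val alpha).
exact/eqP/(valP alpha).
Qed.

End StructureOfAut0.

Theorem proposition3p2 (theta : {multiplicative Z -> GL2Z})
    (hA : anosov (theta Zgen)) (M0 : GL2Z)
    (hM0 : centralizer_root (theta Zgen) M0) :
  let K : set (aut Z * aut ZZ)%type :=
    generated [set (1, mx_aut M0); (1, opp_aut)] in
  range (psi hA) `&` [set q | q.1 = 1] = K /\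
  exists (i : {multiplicative ZZrtimes (expgz M0) -> Aut0 hA})
         (p : {multiplicative Aut0 hA -> Zmod2})
         (chi : (aut Z * aut ZZ)%type -> Zmod2),
  [/\ {in K &, {morph chi : q r / q * r}},
      chi (1, mx_aut M0) = 1,
      chi (1, opp_aut) = Zmod2gen,
      (forall alpha : Aut0 hA, p alpha = chi (psi hA (val alpha))) &
      short_exact i p] /\
  exists (s : {multiplicative Zmod2 -> Aut0 hA})
         (phi : {multiplicative Zmod2 -> aut (ZZrtimes (expgz M0))}),
  [/\ cancel s p,
      val (s Zmod2gen) = gamma_minus theta /\
        psi hA (gamma_minus theta) = (1, opp_aut),
      (forall z g, s z * i g * (s z)^-1 = i (phi z g)),
      (forall (m n : int) (t : Z),
         phi Zmod2gen (SDPair (ZZpair m n) t) =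
         SDPair (ZZpair (- m)%R (- n)%R) t) &
      exists f : {multiplicative sdprod phi -> Aut0 hA},
        bijective f /\ forall g z, f (SDPair g z) = i g * s z].
Proof.
move=> K.
have KE : K = range (word (1, opp_aut) (1, mx_aut M0)).
  exact: generated_word negationK (negation_commute M0).
have [chi chiE] := ex_parity negationK negation_neq1 (negation_commute M0)
  (root_inj hM0).
have wM := wordM negationK (negation_commute M0).
have chiM : {in K &, {morph chi : q r / q * r}}.
  rewrite KE => q r /set_mem[a _ <-] /set_mem[b _ <-].
  by rewrite -wM !chiE.
have chi_root n : chi (1, mx_aut (expgz M0 n)) = 1.
  by rewrite -root_expgz -[RHS](chiE (1, n)) /word expZ2_0 mul1g.
have chi_neg : chi (1, opp_aut) = Zmod2gen.
  by rewrite -[RHS](chiE (Zmod2gen, 1)) /word expZ2_gen mulg1.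
have psiK (alpha : Aut0 hA) : K (psi hA (val alpha)).
  rewrite KE -(@range_psi theta M0 hA hM0); split.
    by exists (val alpha).
  exact/eqP/(valP alpha).
pose p (alpha : Aut0 hA) := chi (psi hA (val alpha)).
have pM : {morph p : a b / a * b}.
  by move=> a b; rewrite /p psiM chiM ?inE.
pose P : {multiplicative Aut0 hA -> Zmod2} :=
  HB.pack p (isMultiplicative.Build _ _ p pM).
have sK : cancel (splitting hA) P.
  apply: Zmod2P; first by rewrite (hom1 (splitting hA)) (hom1 P).
  by rewrite -[splitting hA _]/(expZ2 (gamma0 hA) Zmod2gen) expZ2_gen
    /= /p psi_gamma_minus.
have exact_iP : short_exact (incl hA hM0) P.
  split; first exact: incl_inj.
    apply/seteqP; split=> [_ [g _ <-]|alpha /= pa].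
      by rewrite /= /p psi_incl_fun root_expgz.
    have [[z n] an] := psi_Aut0 hM0 (eqP (valP alpha)).
    have z1 : z = 1 by move: pa; rewrite /p an chiE.
    move: an; rewrite z1 /word expZ2_0 mul1g root_expgz => an.
    exists (SDPair (sdl (val alpha (sdinr _ Zgen))) n) => //.
    by apply: val_inj; rewrite /= -affine_of_aut.
  by apply/seteqP; split=> // z _; exists (splitting hA z).
split; first by rewrite KE -(@range_psi theta M0 hA hM0).
exists (incl hA hM0), P, chi; split; first split => //.
  exact: (chi_root Zgen).
exists (splitting hA), (split_action M0); split=> //.
- split; last exact: psi_gamma_minus.
  by rewrite -[splitting hA _]/(expZ2 (gamma0 hA) Zmod2gen) expZ2_gen.
- exact: splitting_incl.
- move=> m n t.
  rewrite -[split_action _ _]/(expZ2 (gamma_minus (expgz M0)) Zmod2gen).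
  rewrite expZ2_gen; congr SDPair; apply/colP => i; rewrite !mxE.
  by case: ifP.
exact: (split_exact_sdprod exact_iP sK (splitting_incl hA hM0)).
Qed.
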